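(* (GBC) Assume the principle $\mathrm{ETR}_{\mathrm{Ord}}$. Then for any class parameter $A$ there is a truth predicate for $\mathcal L_{\mathrm{Ord},\mathrm{Ord}}(\in,A)$.
   Context: $\mathrm{ETR}_{\mathrm{Ord}}$: for every first-order formula $\varphi(x,X,A)$ and class $A$ there is a class $S\subseteq\mathrm{Ord}\times V$ with $S_\alpha=\{x:\varphi(x,S\restriction\alpha,A)\}$ for all ordinals $\alpha$, where $S_\alpha=\{x:\langle\alpha,x\rangle\in S\}$ and $S\restriction\alpha=S\cap(\alpha\times V)$. $\mathcal L_{\mathrm{Ord},\mathrm{Ord}}(\in,\hat A)$: formulas built from atomic $x=y$, $x\in y$, $x\in\hat A$ by negation, set-sized conjunctions, and set-sized blocks of universal quantifiers. A truth predicate for it is a class $\mathbb T$ of pairs $\langle\varphi,\vec a\rangle$ ($\vec a$ a valuation of the free variables of $\varphi$) with: $\mathbb T(x=y,\langle a,b\rangle)$ iff $a=b$; $\mathbb T(x\in y,\langle a,b\rangle)$ iff $a\in b$; $\mathbb T(x\in\hat A,a)$ iff $a\in A$; $\mathbb T(\bigwedge_{i\in I}\varphi_i,\vec a)$ iff $\mathbb T(\varphi_i,\vec a)$ for all $i$; $\mathbb T(\neg\varphi,\vec a)$ iff not $\mathbb T(\varphi,\vec a)$; $\mathbb T(\forall\vec x\,\varphi,\vec a)$ iff $\mathbb T(\varphi,\vec b^\frown\vec a)$ for all $\vec b$. *)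

(* Defs.v *)
(** Models of class theory are arbitrary (possibly non-standard) two-sorted
    structures; equality on both sorts is interpreted as true equality. *)
Record class_structure : Type := ClassStructure {
  vset : Type;
  vclass : Type;
  set_mem : vset -> vset -> Prop;
  class_mem : vset -> vclass -> Prop
}.

(** Formulas of class theory whose quantifiers range over sets only.  Free set
    variables are drawn from [N], class variables (never quantified) from [K];
    in [fAll p] the bound variable is [None].  [N] and [K] may be any types, as
    a formula mentions only finitely many variables. *)
Inductive fo (K N : Type) : Type :=
| fEq : N -> N -> fo K N
| fIn : N -> N -> fo K N
| fInC : N -> K -> fo K N
| fNot : fo K N -> fo K N
| fAnd : fo K N -> fo K N -> fo K N
| fAll : fo K (option N) -> fo K N.

Arguments fEq {K N}.
Arguments fIn {K N}.
Arguments fInC {K N}.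
Arguments fNot {K N}.
Arguments fAnd {K N}.
Arguments fAll {K N}.

Definition extend {V N : Type} (x : V) (e : N -> V) (i : option N) : V :=
  match i with None => x | Some j => e j end.

(** Class variables are interpreted by predicates on sets, so that a formula can
    be evaluated at a definable class without naming it as an element of
    [vclass]. *)
Fixpoint sat (M : class_structure) {K N : Type}
    (e : N -> vset M) (P : K -> vset M -> Prop) (p : fo K N) {struct p} : Prop :=
  match p with
  | fEq i j => e i = e j
  | fIn i j => set_mem M (e i) (e j)
  | fInC i k => P k (e i)
  | fNot q => ~ sat M e P q
  | fAnd q r => sat M e P q /\ sat M e P r
  | fAll q => forall x : vset M, sat M (extend x e) P q
  end.

Section ClassTheory.

Context {M : class_structure}.

Local Notation V := (vset M).
Local Notation C := (vclass M).
Local Notation "x ∈ y" := (set_mem M x y) (at level 70).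
Local Notation "x ∈c X" := (class_mem M x X) (at level 70).

Definition is_empty (z : V) : Prop := forall x, ~ x ∈ z.

Definition subset (x y : V) : Prop := forall z, z ∈ x -> z ∈ y.

Definition is_upair (p x y : V) : Prop := forall z, z ∈ p <-> z = x \/ z = y.

(** [p = <x, y> = {{x}, {x, y}}] *)
Definition is_opair (p x y : V) : Prop :=
  exists a b, is_upair a x x /\ is_upair b x y /\ is_upair p a b.

Definition is_succ (s x : V) : Prop := forall z, z ∈ s <-> z ∈ x \/ z = x.

(** [<x, y> ∈ X], for a class [X] *)
Definition pair_in (X : C) (x y : V) : Prop :=
  exists p, is_opair p x y /\ p ∈c X.

Definition functional_class (F : C) : Prop :=
  forall x y y', pair_in F x y -> pair_in F x y' -> y = y'.

(** [<x, y> ∈ f], for a set [f] *)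
Definition app (f x y : V) : Prop := exists p, is_opair p x y /\ p ∈ f.

Definition in_dom (x f : V) : Prop := exists y, app f x y.

Definition is_function (f : V) : Prop :=
  (forall p, p ∈ f -> exists x y, is_opair p x y) /\
  (forall x y y', app f x y -> app f x y' -> y = y').

Definition ordinal (a : V) : Prop :=
  (forall x, x ∈ a -> subset x a) /\
  (forall x, x ∈ a -> ~ x ∈ x) /\
  (forall x y z, x ∈ a -> y ∈ a -> z ∈ a -> x ∈ y -> y ∈ z -> x ∈ z) /\
  (forall x y, x ∈ a -> y ∈ a -> x ∈ y \/ x = y \/ y ∈ x) /\
  (forall b, subset b a -> (exists x, x ∈ b) ->
     exists m, m ∈ b /\ forall x, x ∈ b -> m = x \/ m ∈ x).

Record GBC : Prop := {
  set_extensionality : forall x y : V, (forall z, z ∈ x <-> z ∈ y) -> x = y;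
  class_extensionality : forall X Y : C, (forall z, z ∈c X <-> z ∈c Y) -> X = Y;
  pairing : forall x y : V, exists p, is_upair p x y;
  union : forall x : V, exists u, forall z, z ∈ u <-> exists y, y ∈ x /\ z ∈ y;
  power_set : forall x : V, exists p, forall z, z ∈ p <-> subset z x;
  infinity : exists w : V,
    (exists o, is_empty o /\ o ∈ w) /\
    (forall x, x ∈ w -> exists s, is_succ s x /\ s ∈ w);
  foundation : forall x : V, (exists y, y ∈ x) ->
    exists y, y ∈ x /\ forall z, z ∈ y -> ~ z ∈ x;
  comprehension : forall (K N : Type) (p : fo K (option N))
    (e : N -> V) (A : K -> C),
    exists Y : C, forall x, x ∈c Y <->
      sat M (extend x e) (fun k z => z ∈c A k) p;
  (* [F] may be partial on [a], so this also yields separation. *)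
  replacement : forall F : C, functional_class F -> forall a : V,
    exists b, forall y, y ∈ b <-> exists x, x ∈ a /\ pair_in F x y;
  global_choice : exists F : C, functional_class F /\
    forall x : V, (exists y, y ∈ x) -> exists y, y ∈ x /\ pair_in F x y
}.

(** The class variables of a formula [φ(x, X, A)], whose only free set variable
    is the element of [unit]. *)
Inductive etr_var : Type := varX | varA.

(** [p ∈ S ∩ (a × V)] *)
Definition restriction (S : C) (a p : V) : Prop :=
  p ∈c S /\ exists b x, b ∈ a /\ is_opair p b x.

Definition ETR_Ord : Prop :=
  forall (p : fo etr_var unit) (A : C),
  exists S : C,
    (forall q, q ∈c S -> exists a x, ordinal a /\ is_opair q a x) /\
    (forall a, ordinal a -> forall x,
       pair_in S a x <->
       sat M (fun _ => x)
         (fun k z => match k with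
                     | varX => restriction S a z
                     | varA => z ∈c A
                     end) p).

(** Infinitary formulas are coded by sets of the structure, and all notions
    about them are formulated inside the structure: an external inductive type
    would miss codes whenever the membership relation of the structure is
    externally ill-founded.  The variables are [v_α] for [α] an ordinal,
    and [v_α] is coded by [α] itself. *)

Fixpoint numeral (n : nat) (x : V) : Prop :=
  match n with
  | O => is_empty x
  | S m => exists y, numeral m y /\ is_succ x y
  end.

(** [c = <n, y>] *)
Definition tagged (n : nat) (c y : V) : Prop :=
  exists t, numeral n t /\ is_opair c t y.

(** [v_x = v_y] *)
Definition code_eq (c x y : V) : Prop := exists p, is_opair p x y /\ tagged 0 c p.
(** [v_x ∈ v_y] *)
Definition code_in (c x y : V) : Prop := exists p, is_opair p x y /\ tagged 1 c p.
(** [v_x ∈ Â] *)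
Definition code_inA (c x : V) : Prop := tagged 2 c x.
(** [¬ d] *)
Definition code_neg (c d : V) : Prop := tagged 3 c d.
(** [⋀_{i ∈ dom f} f(i)], for a set function [f] *)
Definition code_conj (c f : V) : Prop := tagged 4 c f.
(** [∀ W d], quantifying simultaneously all the variables in the set [W] *)
Definition code_all (c W d : V) : Prop := exists p, is_opair p W d /\ tagged 5 c p.

Definition var_set (W : V) : Prop := forall x, x ∈ W -> ordinal x.

Record formation_closed (X : C) : Prop := {
  form_eq : forall c x y, ordinal x -> ordinal y -> code_eq c x y -> c ∈c X;
  form_in : forall c x y, ordinal x -> ordinal y -> code_in c x y -> c ∈c X;
  form_inA : forall c x, ordinal x -> code_inA c x -> c ∈c X;
  form_neg : forall c d, d ∈c X -> code_neg c d -> c ∈c X;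
  form_conj : forall c f, is_function f -> (forall i d, app f i d -> d ∈c X) ->
    code_conj c f -> c ∈c X;
  form_all : forall c W d, var_set W -> d ∈c X -> code_all c W d -> c ∈c X
}.

Definition formula (c : V) : Prop :=
  forall X : C, formation_closed X -> c ∈c X.

Record occurrence_closed (X : C) : Prop := {
  occ_eq : forall c x y, code_eq c x y -> pair_in X x c /\ pair_in X y c;
  occ_in : forall c x y, code_in c x y -> pair_in X x c /\ pair_in X y c;
  occ_inA : forall c x, code_inA c x -> pair_in X x c;
  occ_neg : forall c d x, code_neg c d -> pair_in X x d -> pair_in X x c;
  occ_conj : forall c f i d x, code_conj c f -> app f i d ->
    pair_in X x d -> pair_in X x c;
  occ_all : forall c W d x, code_all c W d -> ~ x ∈ W ->
    pair_in X x d -> pair_in X x c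
}.

Definition free_in (x c : V) : Prop :=
  forall X : C, occurrence_closed X -> pair_in X x c.

(** The domain of [a] is exactly the set of free variables of [c]. *)
Definition valuation (c a : V) : Prop :=
  is_function a /\ forall x, in_dom x a <-> free_in x c.

(** Since valuations have exact domains, in the clause for [⋀] the valuation
    [a] is restricted to the free variables of each conjunct, and in the clause
    for [∀ W d] the concatenation [b ∪ a], with [b] a valuation of [W], is
    restricted to the free variables of [d] (a variable in [W] need not occur
    in [d]). *)
Record truth_predicate (A T : C) : Prop := {
  truth_domain : forall q, q ∈c T ->
    exists c a, is_opair q c a /\ formula c /\ valuation c a;
  truth_eq : forall c x y a u v,
    ordinal x -> ordinal y -> code_eq c x y -> valuation c a ->
    app a x u -> app a y v ->
    (pair_in T c a <-> u = v);
  truth_in : forall c x y a u v,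
    ordinal x -> ordinal y -> code_in c x y -> valuation c a ->
    app a x u -> app a y v ->
    (pair_in T c a <-> u ∈ v);
  truth_inA : forall c x a u,
    ordinal x -> code_inA c x -> valuation c a -> app a x u ->
    (pair_in T c a <-> u ∈c A);
  truth_conj : forall c f a,
    formula c -> code_conj c f -> valuation c a ->
    (pair_in T c a <->
     forall i d a', app f i d -> valuation d a' -> subset a' a ->
       pair_in T d a');
  truth_neg : forall c d a,
    formula c -> code_neg c d -> valuation c a ->
    (pair_in T c a <-> ~ pair_in T d a);
  truth_all : forall c W d a,
    formula c -> code_all c W d -> valuation c a ->
    (pair_in T c a <->
     forall b a', is_function b -> (forall x, in_dom x b <-> x ∈ W) ->
       valuation d a' -> (forall q, q ∈ a' -> q ∈ b \/ q ∈ a) ->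
       pair_in T d a')
}.

End ClassTheory.

Arguments GBC M : clear implicits.
Arguments ETR_Ord M : clear implicits.

(* Main.v *)
(** The class of pairs [<x, c>] with [x] free in [c] is the union of the stages
    of an inductive definition iterated along the ordinals, so ETR turns the
    second-order notion of free variable into a class parameter.  A second
    recursion builds simultaneously the [α]-th stage of the formulas and truth
    for the formulas of stage [α], the latter from truth at the stages
    [β < α].  Carrying the stages of the formulas along makes
    "[c] is a formula of stage [α]" expressible from the earlier part of the
    recursion, although [α] itself is not available to the formula in ETR. *)

From Stdlib Require Import Classical.
Require Import Defs.

(** * Relations expressible by first-order formulas *)

Section Definability.

Context {M : class_structure}.

(** A semantic stand-in for writing syntax by hand. The formula is fixed before [e] and [P], so it
    serves all environments and all interpretations of the class variables. *)
Definition definable {K N : Type}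
    (R : (N -> vset M) -> (K -> vset M -> Prop) -> Prop) : Prop :=
  exists p : fo K N, forall e P, sat M e P p <-> R e P.

Context {K N : Type}.

Implicit Types R Q : (N -> vset M) -> (K -> vset M -> Prop) -> Prop.

Lemma definable_eq (i j : N) : definable (K := K) (fun e P => e i = e j).
Proof. exists (fEq i j); simpl; tauto. Qed.

Lemma definable_mem (i j : N) : definable (K := K) (fun e P => set_mem M (e i) (e j)).
Proof. exists (fIn i j); simpl; tauto. Qed.

Lemma definable_class (k : K) (i : N) : definable (fun e P => P k (e i)).
Proof. exists (fInC i k); simpl; tauto. Qed.

Lemma definable_not R : definable R -> definable (fun e P => ~ R e P).
Proof. intros [p hp]; exists (fNot p); intros e P; simpl; rewrite hp; tauto. Qed.

Lemma definable_and R Q :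
  definable R -> definable Q -> definable (fun e P => R e P /\ Q e P).
Proof.
  intros [p hp] [q hq]; exists (fAnd p q); intros e P; simpl; rewrite hp, hq; tauto.
Qed.

Lemma definable_ext R Q :
  (forall e P, R e P <-> Q e P) -> definable R -> definable Q.
Proof. intros h [p hp]; exists p; intros e P; rewrite hp; apply h. Qed.

Lemma definable_or R Q :
  definable R -> definable Q -> definable (fun e P => R e P \/ Q e P).
Proof.
  intros hR hQ.
  apply (definable_ext (fun e P => ~ (~ R e P /\ ~ Q e P))).
  - intros e P; tauto.
  - auto using definable_not, definable_and.
Qed.

Lemma definable_imp R Q :
  definable R -> definable Q -> definable (fun e P => R e P -> Q e P).
Proof.
  intros hR hQ.
  apply (definable_ext (fun e P => ~ (R e P /\ ~ Q e P))).
  - intros e P; tauto.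
  - auto using definable_not, definable_and.
Qed.

Lemma definable_iff R Q :
  definable R -> definable Q -> definable (fun e P => R e P <-> Q e P).
Proof. intros hR hQ; unfold iff; auto using definable_imp, definable_and. Qed.

(** The bound variable is the entry [None] of the larger environment; [extend x e] along [Some] is
    convertible to [e], so the clause of [sat] for [fAll] matches definitionally. *)
Lemma definable_all (R : vset M -> (N -> vset M) -> (K -> vset M -> Prop) -> Prop) :
  definable (N := option N) (fun e P => R (e None) (fun i => e (Some i)) P) ->
  definable (fun e P => forall x, R x e P).
Proof.
  intros [p hp]; exists (fAll p); intros e P; simpl.
  split; intros h x; [exact (proj1 (hp (extend x e) P) (h x))
    |exact (proj2 (hp (extend x e) P) (h x))].
Qed.

End Definability.

Lemma definable_ex {M : class_structure} {K N : Type}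
    (R : vset M -> (N -> vset M) -> (K -> vset M -> Prop) -> Prop) :
  definable (N := option N) (fun e P => R (e None) (fun i => e (Some i)) P) ->
  definable (fun e P => exists x, R x e P).
Proof.
  intros hR.
  apply (definable_ext (fun e P => ~ forall x, ~ R x e P)).
  - intros e P; split.
    + intros h; apply not_all_ex_not in h; destruct h as [x h]; exists x; tauto.
    + intros [x h] h'; exact (h' x h).
  - apply definable_not, (definable_all (fun x e P => ~ R x e P)), definable_not, hR.
Qed.

Lemma definable_numeral {M : class_structure} (n : nat) {K N : Type} (i : N) :
  definable (M := M) (K := K) (fun e P => numeral n (e i)).
Proof.
  revert N i; induction n as [|n IH]; intros N i; simpl.
  - apply (definable_all (fun x e P => ~ set_mem M x (e i))).
    apply definable_not, definable_mem.
  - apply (definable_ex (fun y e P => numeral n y /\ is_succ (e i) y)).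
    apply definable_and; [apply IH|].
    apply (definable_all (fun z (e : option N -> vset M) (P : K -> vset M -> Prop) =>
      set_mem M z (e (Some i)) <-> set_mem M z (e None) \/ z = e None)).
    apply definable_iff; [apply definable_mem|].
    apply definable_or; [apply definable_mem|apply definable_eq].
Qed.

Create HintDb class_theory.
#[local] Hint Unfold is_empty subset is_upair is_opair is_succ app in_dom is_function
  ordinal tagged code_eq code_in code_inA code_neg code_conj code_all var_set
  : class_theory.

(** The order matters: a negation unfolds to an implication, an equivalence to a conjunction, and an
    implication is itself a product, so the more special connective is tried first. *)
Ltac definability :=
  autounfold with class_theory;
  repeat (cbv beta; first
    [ apply definable_eq | apply definable_mem | apply definable_class
    | apply definable_numeral | apply definable_not | apply definable_iff
    | apply definable_and | apply definable_or | apply definable_imp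
    | apply definable_all | apply definable_ex ]).

(** * Pairs, numerals and tagged codes inside a model of GBC *)

Section Proof.

Context {M : class_structure} (hGBC : GBC M).

Local Notation V := (vset M).
Local Notation C := (vclass M).
Local Notation "x ∈ y" := (set_mem M x y) (at level 70).
Local Notation "x ∈c X" := (class_mem M x X) (at level 70).

Definition is_class (Q : V -> Prop) : Prop := exists Y : C, forall x, x ∈c Y <-> Q x.

(** Every set and every class of the structure is available as a parameter:
    [e (Some a)] is [a], and [P X] is [X]. *)
Lemma comprehend (R : (option V -> V) -> (C -> V -> Prop) -> Prop) :
  definable R ->
  is_class (fun x => R (extend x (fun v => v)) (fun X z => z ∈c X)).
Proof.
  intros [p hp].
  destruct (comprehension hGBC C V p (fun v => v) (fun X => X)) as [Y hY].
  exists Y; intros x; rewrite hY; apply hp.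
Qed.

Lemma opair_exists (x y : V) : exists p, is_opair p x y.
Proof.
  destruct (pairing hGBC x x) as [a ha], (pairing hGBC x y) as [b hb].
  destruct (pairing hGBC a b) as [p hp].
  exists p, a, b; auto.
Qed.

Lemma upair_unique (p q x y : V) : is_upair p x y -> is_upair q x y -> p = q.
Proof.
  intros hp hq; apply (set_extensionality hGBC); intros z; rewrite (hp z), (hq z); tauto.
Qed.

Lemma opair_unique (p q x y : V) : is_opair p x y -> is_opair q x y -> p = q.
Proof.
  intros (a & b & ha & hb & hp) (a' & b' & ha' & hb' & hq).
  rewrite (upair_unique _ _ _ _ ha' ha), (upair_unique _ _ _ _ hb' hb) in hq.
  exact (upair_unique _ _ _ _ hp hq).
Qed.

Lemma opair_inj (p x y x' y' : V) :
  is_opair p x y -> is_opair p x' y' -> x = x' /\ y = y'.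
Proof.
  intros (a & b & ha & hb & hp) (a' & b' & ha' & hb' & hp').
  assert (E : x = x').
  { assert (h : a ∈ p) by (apply hp; auto).
    apply hp' in h as [->| ->].
    - assert (h : x ∈ a') by (apply ha; auto). apply ha' in h; tauto.
    - assert (h : x' ∈ b') by (apply hb'; auto). apply ha in h; firstorder. }
  subst x'; split; [reflexivity|].
  rewrite (upair_unique _ _ _ _ ha' ha) in hp'.
  assert (h : b ∈ p) by (apply hp; auto).
  assert (h' : b' ∈ p) by (apply hp'; auto).
  assert (hy : y ∈ b) by (apply hb; auto).
  assert (hy' : y' ∈ b') by (apply hb'; auto).
  apply hp' in h; apply hp in h'.
  (* [{x, y}] may collapse to [{x}], so each second coordinate is only known to be [x] or the other
     one; the two disjunctions together force equality. *)
  assert (y = x \/ y = y').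
  { destruct h as [->| ->]; [apply ha in hy|apply hb' in hy]; tauto. }
  assert (y' = x \/ y' = y).
  { destruct h' as [->| ->]; [apply ha in hy'|apply hb in hy']; tauto. }
  intuition congruence.
Qed.

Lemma pair_in_iff (X : C) (p x y : V) : is_opair p x y -> (pair_in X x y <-> p ∈c X).
Proof.
  intros hp; split.
  - intros (q & hq & h); rewrite (opair_unique _ _ _ _ hp hq); exact h.
  - exists p; auto.
Qed.

(** Foundation applied to the unordered pair of [x] and [y]. *)
Lemma mem_asym (x y : V) : x ∈ y -> ~ y ∈ x.
Proof.
  intros hxy hyx.
  destruct (pairing hGBC x y) as [p hp].
  destruct (foundation hGBC p) as (z & hz & hmin).
  - exists x; apply hp; auto.
  - apply hp in hz as [->| ->].
    + apply (hmin y hyx), hp; auto.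
    + apply (hmin x hxy), hp; auto.
Qed.

Lemma mem_irrefl (x : V) : ~ x ∈ x.
Proof. intros h; exact (mem_asym x x h h). Qed.

Lemma succ_exists (x : V) : exists s, is_succ s x.
Proof.
  destruct (pairing hGBC x x) as [a ha], (pairing hGBC x a) as [p hp].
  destruct (union hGBC p) as [u hu].
  exists u; intros z; rewrite hu; split.
  - intros (y & hy & hz); apply hp in hy as [->| ->]; [tauto|].
    apply ha in hz; tauto.
  - intros [h| ->]; [exists x|exists a]; split; auto; [apply hp|apply hp|apply ha]; auto.
Qed.

(** If [x] and [y] differed, each would be an element of the other. *)
Lemma succ_inj (s x y : V) : is_succ s x -> is_succ s y -> x = y.
Proof.
  intros hx hy.
  assert (h : x ∈ s) by (apply hx; auto).
  assert (h' : y ∈ s) by (apply hy; auto).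
  apply hy in h; apply hx in h'.
  destruct h as [h|]; [|auto]; destruct h' as [h'|]; [|auto].
  destruct (mem_asym _ _ h h').
Qed.

Lemma numeral_exists (n : nat) : exists x : V, numeral n x.
Proof.
  induction n as [|n [x hx]]; simpl.
  - destruct (infinity hGBC) as (w & (o & ho & _) & _); exists o; exact ho.
  - destruct (succ_exists x) as [s hs]; exists s, x; auto.
Qed.

Lemma numeral_unique (n : nat) (x y : V) : numeral n x -> numeral n y -> x = y.
Proof.
  revert x y; induction n as [|n IH]; simpl; intros x y.
  - intros hx hy; apply (set_extensionality hGBC); firstorder.
  - intros (x' & hx & hsx) (y' & hy & hsy).
    rewrite (IH _ _ hx hy) in hsx.
    apply (set_extensionality hGBC); intros z; rewrite (hsx z), (hsy z); tauto.
Qed.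

Lemma numeral_inj (n m : nat) (x : V) : numeral n x -> numeral m x -> n = m.
Proof.
  revert m x; induction n as [|n IH]; intros [|m] x; simpl; auto.
  - intros h (y & _ & hy); destruct (h y); apply hy; auto.
  - intros (y & _ & hy) h; destruct (h y); apply hy; auto.
  - intros (y & hy & hs) (z & hz & hs').
    rewrite (succ_inj _ _ _ hs' hs) in hz; f_equal; eauto.
Qed.

Lemma tagged_exists (n : nat) (y : V) : exists c, tagged n c y.
Proof.
  destruct (numeral_exists n) as [t ht], (opair_exists t y) as [c hc].
  exists c, t; auto.
Qed.

Lemma tagged_unique (n : nat) (c c' y : V) : tagged n c y -> tagged n c' y -> c = c'.
Proof.
  intros (t & ht & hc) (t' & ht' & hc').
  rewrite (numeral_unique _ _ _ ht' ht) in hc'; exact (opair_unique _ _ _ _ hc hc').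
Qed.

Lemma tagged_inj (n m : nat) (c y z : V) : tagged n c y -> tagged m c z -> n = m /\ y = z.
Proof.
  intros (t & ht & hc) (t' & ht' & hc').
  destruct (opair_inj _ _ _ _ _ hc hc') as [<- <-]; eauto using numeral_inj.
Qed.

(** ** Ordinals *)

(** Replacement along the identity restricted to [Q], a partial functional class. *)
Lemma separation (a : V) (Q : C) : exists b, forall x, x ∈ b <-> x ∈ a /\ x ∈c Q.
Proof.
  destruct (comprehend (fun e P => exists x, is_opair (e None) x x /\ P Q x))
    as [F hF]; [definability|]; simpl in hF.
  assert (hF' : forall x y, pair_in F x y <-> x = y /\ x ∈c Q).
  { intros x y; destruct (opair_exists x y) as [p hp].
    rewrite (pair_in_iff _ _ _ _ hp), hF; split.
    - intros (z & hz & h); destruct (opair_inj _ _ _ _ _ hp hz); subst; auto.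
    - intros [-> h]; exists y; auto. }
  destruct (replacement hGBC F) with (a := a) as [b hb].
  - intros x y y' h h'; apply hF' in h, h'; intuition congruence.
  - exists b; intros x; rewrite hb; split.
    + intros (y & hy & h); apply hF' in h; intuition congruence.
    + intros [h h']; exists x; split; [|apply hF']; auto.
Qed.

Lemma inter_exists (a b : V) : exists c, forall x, x ∈ c <-> x ∈ a /\ x ∈ b.
Proof.
  destruct (comprehend (fun e P => e None ∈ e (Some b))) as [Q hQ]; [definability|].
  simpl in hQ; destruct (separation a Q) as [c hc].
  exists c; intros x; rewrite hc, hQ; tauto.
Qed.

Lemma diff_exists (a b : V) : exists c, forall x, x ∈ c <-> x ∈ a /\ ~ x ∈ b.
Proof.
  destruct (comprehend (fun e P => ~ e None ∈ e (Some b))) as [Q hQ]; [definability|].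
  simpl in hQ; destruct (separation a Q) as [c hc].
  exists c; intros x; rewrite hc, hQ; tauto.
Qed.

(** Foundation gives irreflexivity and a minimal element of each nonempty subset; trichotomy turns
    minimal into least. *)
Lemma ordinal_intro (a : V) :
  (forall x, x ∈ a -> subset x a) ->
  (forall x y, x ∈ a -> y ∈ a -> x ∈ y \/ x = y \/ y ∈ x) ->
  (forall x, x ∈ a -> forall y, y ∈ x -> subset y x) ->
  ordinal a.
Proof.
  intros htr htri hel; split; [exact htr|]; split; [|split; [|split; [exact htri|]]].
  - intros x _; apply mem_irrefl.
  - intros x y z _ _ hz hxy hyz; exact (hel z hz y hyz x hxy).
  - intros b hb hne; destruct (foundation hGBC b hne) as (m & hm & hmin).
    exists m; split; [exact hm|]; intros x hx.
    destruct (htri m x (hb _ hm) (hb _ hx)) as [h|[h|h]]; auto.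
    destruct (hmin x h hx).
Qed.

Lemma ordinal_trans (a x y : V) : ordinal a -> x ∈ a -> y ∈ x -> y ∈ a.
Proof. intros (h & _) hx hy; exact (h x hx y hy). Qed.

Lemma ordinal_elem (a x : V) : ordinal a -> x ∈ a -> ordinal x.
Proof.
  intros (h1 & h2 & h3 & h4 & h5) hx.
  assert (hsub := h1 x hx).
  apply ordinal_intro.
  - intros y hy z hz; apply (h3 z y x); auto; exact (h1 y (hsub y hy) z hz).
  - intros y z hy hz; auto.
  - intros z hz y hy w hw.
    assert (hy' := h1 z (hsub z hz) y hy).
    apply (h3 w y z); auto; exact (h1 y hy' w hw).
Qed.

(** The least element of the difference of [b] and [a], if there is one, is [a] itself. *)
Lemma ordinal_subset (a b : V) : ordinal a -> ordinal b -> subset a b -> a = b \/ a ∈ b.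
Proof.
  intros ha hb hab.
  destruct (diff_exists b a) as [d hd].
  destruct (classic (exists x, x ∈ d)) as [hne|hempty].
  - right; destruct hb as (b1 & b2 & b3 & b4 & b5).
    destruct (b5 d) as (m & hm & hmin); [intros x hx; apply hd in hx; tauto|exact hne|].
    apply hd in hm as [hmb hma].
    enough (a = m) by (subst; exact hmb).
    apply (set_extensionality hGBC); intros x; split.
    + intros hx; destruct (b4 x m (hab x hx) hmb) as [h|[->|h]]; auto.
      * contradiction.
      * destruct (hma (ordinal_trans _ _ _ ha hx h)).
    + intros hx; apply NNPP; intros hxa.
      assert (hxd : x ∈ d) by (apply hd; split; [exact (b1 m hmb x hx)|exact hxa]).
      destruct (hmin x hxd) as [<-|h]; [exact (mem_irrefl _ hx)|exact (mem_asym _ _ h hx)].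
  - left; apply (set_extensionality hGBC); intros x; split; [apply hab|].
    intros hx; apply NNPP; intros hxa; apply hempty; exists x; apply hd; auto.
Qed.

(** The intersection of [a] and [b] is an ordinal; were it a proper subset of both, it would be an
    element of both and hence of itself. *)
Lemma ordinal_trichotomy (a b : V) : ordinal a -> ordinal b -> a ∈ b \/ a = b \/ b ∈ a.
Proof.
  intros ha hb; destruct (inter_exists a b) as [c hc].
  assert (hoc : ordinal c).
  { destruct ha as (a1 & a2 & a3 & a4 & a5), hb as (b1 & _).
    apply ordinal_intro.
    - intros x hx y hy; apply hc in hx; apply hc; split; [apply (a1 x)|apply (b1 x)]; tauto.
    - intros x y hx hy; apply hc in hx, hy; apply a4; tauto.
    - intros z hz y hy x hx; apply hc in hz as [hz _].
      assert (hy' := a1 z hz y hy); apply (a3 x y z); auto; exact (a1 y hy' x hx). }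
  destruct (ordinal_subset c a hoc ha) as [->|h]; [intros x hx; apply hc in hx; tauto| |].
  - destruct (ordinal_subset a b hoc hb); auto; intros x hx; apply hc in hx; tauto.
  - destruct (ordinal_subset c b hoc hb) as [->|h']; [intros x hx; apply hc in hx; tauto|auto|].
    destruct (mem_irrefl c); apply hc; auto.
Qed.

Lemma ordinal_succ (a s : V) : ordinal a -> is_succ s a -> ordinal s.
Proof.
  intros ha hs; apply ordinal_intro.
  - intros x hx y hy; apply hs; left; apply hs in hx as [hx| ->]; auto.
    exact (ordinal_trans _ _ _ ha hx hy).
  - intros x y hx hy.
    apply ordinal_trichotomy; [apply hs in hx as [h| ->]|apply hs in hy as [h| ->]];
      eauto using ordinal_elem.
  - intros x hx y hy z hz.
    assert (hox : ordinal x) by (apply hs in hx as [h| ->]; eauto using ordinal_elem).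
    exact (ordinal_trans _ _ _ hox hy hz).
Qed.

(** The union of [b] is an ordinal that includes every element of [b] as a subset, so its successor
    has each of them as an element. *)
Lemma ordinal_bound (b : V) :
  (forall x, x ∈ b -> ordinal x) ->
  exists d, ordinal d /\ forall x, x ∈ b -> x ∈ d.
Proof.
  intros hb; destruct (union hGBC b) as [u hu].
  assert (hou : ordinal u).
  { apply ordinal_intro.
    - intros x hx y hy; apply hu in hx as (a & ha & hx); apply hu; exists a; split; auto.
      exact (ordinal_trans _ _ _ (hb a ha) hx hy).
    - intros x y hx hy; apply hu in hx as (a & ha & hx), hy as (a' & ha' & hy).
      apply ordinal_trichotomy; eauto using ordinal_elem.
    - intros x hx y hy z hz; apply hu in hx as (a & ha & hx).
      assert (hox : ordinal x) by eauto using ordinal_elem.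
      exact (ordinal_trans _ _ _ hox hy hz). }
  destruct (succ_exists u) as [s hs]; exists s; split; [eauto using ordinal_succ|].
  intros x hx; apply hs.
  destruct (ordinal_subset x u (hb x hx) hou) as [->|h]; auto.
  intros y hy; apply hu; exists x; auto.
Qed.

Definition least_ordinal (Q : V -> Prop) (a : V) : Prop :=
  ordinal a /\ Q a /\ forall b, b ∈ a -> ~ Q b.

(** The well-ordering clause of [ordinal] concerns subsets that are sets, so the search runs over
    the elements of [a] satisfying [Q]; if there are none, [a] is least. *)
Lemma least_ordinal_exists (Q : V -> Prop) (a : V) :
  is_class Q -> ordinal a -> Q a -> exists m, least_ordinal Q m.
Proof.
  intros [Y hY] ha hQ; destruct (separation a Y) as [d hd].
  assert (hd' : forall x, x ∈ d <-> x ∈ a /\ Q x) by (intros x; rewrite hd, hY; tauto).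
  destruct (classic (exists x, x ∈ d)) as [hne|hempty].
  - assert (ha' := ha); destruct ha as (a1 & a2 & a3 & a4 & a5).
    destruct (a5 d) as (m & hm & hmin); [intros x hx; apply hd' in hx; tauto|exact hne|].
    apply hd' in hm as [hma hmQ].
    exists m; split; [eauto using ordinal_elem|]; split; [exact hmQ|].
    intros b hb hbQ.
    assert (hbd : b ∈ d) by (apply hd'; split; [exact (a1 m hma b hb)|exact hbQ]).
    destruct (hmin b hbd) as [<-|h]; [exact (mem_irrefl _ hb)|exact (mem_asym _ _ h hb)].
  - exists a; split; [exact ha|]; split; [exact hQ|].
    intros b hb hbQ; apply hempty; exists b; apply hd'; auto.
Qed.

Lemma least_ordinal_unique (Q : V -> Prop) (a b : V) :
  least_ordinal Q a -> least_ordinal Q b -> a = b.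
Proof.
  intros (ha & hQa & hla) (hb & hQb & hlb).
  destruct (ordinal_trichotomy a b ha hb) as [h|[h|h]]; auto.
  - destruct (hlb a h hQa).
  - destruct (hla b h hQb).
Qed.

(** The structure may be externally ill-founded, so induction is restricted to properties that are
    classes of the structure: a counterexample then yields a least one. *)
Lemma ordinal_induction (Q : V -> Prop) :
  is_class Q ->
  (forall a, ordinal a -> (forall b, b ∈ a -> Q b) -> Q a) ->
  forall a, ordinal a -> Q a.
Proof.
  intros [Y hY] hstep a ha; apply NNPP; intros hQa.
  destruct (least_ordinal_exists (fun x => ~ Q x) a) as (m & hm & hmQ & hmin); auto.
  - destruct (comprehend (fun e P => ~ P Y (e None))) as [Y' hY']; [definability|].
    exists Y'; intros x; rewrite hY', hY; tauto.
  - apply hmQ, hstep; auto; intros b hb; apply NNPP; exact (hmin b hb).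
Qed.

Lemma ordinal_exists : exists a : V, ordinal a.
Proof.
  destruct (numeral_exists 0) as [z hz]; simpl in hz.
  destruct (ordinal_bound z) as (a & ha & _); [|exists a; exact ha].
  intros x hx; destruct (hz x hx).
Qed.

Lemma ordinal_above (a : V) : ordinal a -> exists b, ordinal b /\ a ∈ b.
Proof.
  intros ha; destruct (succ_exists a) as [s hs].
  exists s; split; [exact (ordinal_succ a s ha hs)|apply hs; auto].
Qed.

(** ** Recursion along the ordinals *)

Context (hETR : ETR_Ord M).

(** Forgets the stage: applied to a restriction of the recursion, it is the union of the earlier
    stages. *)
Definition earlier (X : V -> Prop) (q : V) : Prop := exists b r, is_opair r b q /\ X r.

Lemma etr_recursion (R : (unit -> V) -> (etr_var -> V -> Prop) -> Prop) (A : C) :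
  definable R ->
  exists S : C, forall a, ordinal a -> forall x,
    pair_in S a x <->
    R (fun _ => x) (fun k z => match k with
                               | varX => restriction S a z
                               | varA => z ∈c A
                               end).
Proof.
  intros [p hp]; destruct (hETR p A) as (S & _ & hS).
  exists S; intros a ha x; rewrite (hS a ha x); apply hp.
Qed.

Lemma earlier_restriction (S : C) (a q : V) :
  earlier (restriction S a) q <-> exists b, b ∈ a /\ pair_in S b q.
Proof.
  split.
  - intros (b & r & hr & hS & b' & q' & hb & hr').
    destruct (opair_inj _ _ _ _ _ hr hr') as [<- <-]; exists b; split; [|exists r]; auto.
  - intros (b & hb & r & hr & hS).
    exists b, r; split; [|split; [|exists b, q]]; auto.
Qed.

(** ** Free variables *)

(** The rules of [occurrence_closed] as one operator, whose least fixed point can be built in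
    stages. *)
Definition occ_step (Y : V -> V -> Prop) (x c : V) : Prop :=
  (exists y, code_eq c x y \/ code_eq c y x \/ code_in c x y \/ code_in c y x) \/
  code_inA c x \/
  (exists d, code_neg c d /\ Y x d) \/
  (exists f i d, code_conj c f /\ app f i d /\ Y x d) \/
  (exists W d, code_all c W d /\ ~ x ∈ W /\ Y x d).

Lemma occ_step_mono (Y Y' : V -> V -> Prop) (x c : V) :
  (forall d, Y x d -> Y' x d) -> occ_step Y x c -> occ_step Y' x c.
Proof.
  intros h [H|[H|[(d & H)|[(f & i & d & H)|(W & d & H)]]]]; unfold occ_step.
  - auto.
  - auto.
  - right; right; left; exists d; intuition auto.
  - right; right; right; left; exists f, i, d; intuition auto.
  - right; right; right; right; exists W, d; intuition auto.
Qed.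

(** Every rule has at most one occurrence as premise, so any stage after that of the premise reaches
    the conclusion. *)
Lemma occ_step_premise (Y : V -> V -> Prop) (x c : V) :
  occ_step Y x c ->
  occ_step (fun _ _ => False) x c \/ exists d, Y x d /\ occ_step (fun _ d' => d' = d) x c.
Proof.
  intros [H|[H|[(d & H)|[(f & i & d & H)|(W & d & H)]]]]; unfold occ_step.
  - auto.
  - auto.
  - right; exists d; split; [tauto|]; right; right; left; exists d; tauto.
  - right; exists d; split; [tauto|]; right; right; right; left; exists f, i, d; tauto.
  - right; exists d; split; [tauto|]; right; right; right; right; exists W, d; tauto.
Qed.

Lemma occurrence_closed_iff (X : C) :
  occurrence_closed X <-> forall x c, occ_step (pair_in X) x c -> pair_in X x c.
Proof.
  split.
  - intros [h1 h2 h3 h4 h5 h6] x c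
      [(y & [H|[H|[H|H]]])|[H|[(d & H & H')|[(f & i & d & H & H1 & H2)|(W & d & H & H1 & H2)]]]];
      try apply h1 in H; try apply h2 in H; try tauto; eauto.
  - intros h; split; intros; try split; apply h; unfold occ_step; eauto 10.
Qed.

Lemma free_in_class (A : C) : exists Fr : C, forall x c, pair_in Fr x c <-> free_in x c.
Proof.
  destruct (etr_recursion (fun e P => exists x c, is_opair (e tt) x c /\
      occ_step (fun x d => exists q, is_opair q x d /\ earlier (P varX) q) x c) A)
    as [S hS]; [unfold occ_step, earlier; definability|].
  assert (hS' : forall a p x c, ordinal a -> is_opair p x c ->
    (pair_in S a p <->
     occ_step (fun x d => exists b q, b ∈ a /\ is_opair q x d /\ pair_in S b q) x c)).
  { intros a p x c ha hp; rewrite (hS a ha p); split.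
    - intros (x' & c' & hp' & h); destruct (opair_inj _ _ _ _ _ hp hp') as [<- <-].
      revert h; apply occ_step_mono; intros d (q & hq & h).
      apply earlier_restriction in h as (b & hb & h); exists b, q; auto.
    - intros h; exists x, c; split; [exact hp|].
      revert h; apply occ_step_mono; intros d (b & q & hb & hq & h).
      exists q; split; [exact hq|]; apply earlier_restriction; exists b; auto. }
  assert (hpair : forall a p, ordinal a -> pair_in S a p -> exists x c, is_opair p x c).
  { intros a p ha h; apply (hS a ha) in h as (x & c & h & _); exists x, c; exact h. }
  destruct (comprehend (fun e P => exists a q,
      ordinal a /\ is_opair q a (e None) /\ P S q)) as [Fr hFr]; [definability|].
  cbv beta in hFr; simpl in hFr.
  assert (hFr' : forall x c p, is_opair p x c ->
    (pair_in Fr x c <-> exists a, ordinal a /\ pair_in S a p)).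
  { intros x c p hp; rewrite (pair_in_iff _ _ _ _ hp), hFr; split.
    - intros (a & q & ha & hq & h); exists a; split; [|exists q]; auto.
    - intros (a & ha & q & hq & h); exists a, q; auto. }
  exists Fr; intros x c; split.
  (* Each stage lies inside each occurrence-closed [X], by induction on the stage; the induction
     predicate has only [S] and [X] as parameters, hence is a class. *)
  - intros h X hX.
    destruct (opair_exists x c) as [p hp]; apply (hFr' x c p hp) in h as (a & ha & h).
    apply (pair_in_iff _ _ _ _ hp); revert p x c hp h.
    enough (H : forall a, ordinal a -> forall p, pair_in S a p -> p ∈c X) by eauto.
    clear a ha; apply (ordinal_induction (fun a => forall p, pair_in S a p -> p ∈c X)).
    + refine (comprehend (fun e P =>
        forall p, (exists q, is_opair q (e None) p /\ P S q) -> P X p) _).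
      definability.
    + intros a ha IH p h.
      destruct (hpair a p ha h) as (x & c & hp).
      apply (hS' a p x c ha hp) in h.
      rewrite <- (pair_in_iff _ _ _ _ hp); apply (proj1 (occurrence_closed_iff X) hX).
      revert h; apply occ_step_mono; intros d (b & q & hb & hq & h).
      exists q; split; [exact hq|exact (IH b hb q h)].
  (* The union of the stages is itself occurrence-closed, so [free_in] can be instantiated at it. *)
  - intros h; apply h, occurrence_closed_iff; clear x c h; intros x c h.
    destruct (opair_exists x c) as [p hp]; apply (hFr' x c p hp).
    apply occ_step_premise in h as [h|(d & hd & h)].
    + destruct ordinal_exists as [a ha]; exists a; split; [exact ha|].
      apply (hS' a p x c ha hp); revert h; apply occ_step_mono; tauto.
    + destruct (opair_exists x d) as [q hq]; apply (hFr' x d q hq) in hd as (a & ha & hd).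
      destruct (ordinal_above a ha) as (b & hb & hab); exists b; split; [exact hb|].
      apply (hS' b p x c hb hp); revert h; apply occ_step_mono; intros d' ->.
      exists a, q; auto.
Qed.

(** ** Simultaneous recursion for formulas and truth *)

Definition immediate_subformula (d c : V) : Prop :=
  code_neg c d \/ (exists f i, code_conj c f /\ app f i d) \/ exists W, code_all c W d.

(** The rules of [formation_closed] as one operator. In contrast to [occ_step], the conjunction rule
    has set-many premises, whose stages must be bounded together. *)
Definition form_step (Y : V -> Prop) (c : V) : Prop :=
  (exists x y, ordinal x /\ ordinal y /\ (code_eq c x y \/ code_in c x y)) \/
  (exists x, ordinal x /\ code_inA c x) \/
  (exists d, Y d /\ code_neg c d) \/
  (exists f, is_function f /\ (forall i d, app f i d -> Y d) /\ code_conj c f) \/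
  (exists W d, var_set W /\ Y d /\ code_all c W d).

Lemma form_step_mono (Y Y' : V -> Prop) (c : V) :
  (forall d, Y d -> Y' d) -> form_step Y c -> form_step Y' c.
Proof.
  intros h [H|[H|[(d & H)|[(f & H1 & H2 & H3)|(W & d & H)]]]]; unfold form_step.
  - auto.
  - auto.
  - right; right; left; exists d; intuition auto.
  - right; right; right; left; exists f; split; [|split]; eauto.
  - right; right; right; right; exists W, d; intuition auto.
Qed.

(** Unique readability: two readings of one code have the same tag and the same components, and
    clashing tags are refuted. *)
Ltac code_inversion :=
  repeat match goal with
  | H : code_eq _ _ _ |- _ => destruct H as (? & ? & ?)
  | H : code_in _ _ _ |- _ => destruct H as (? & ? & ?)
  | H : code_all _ _ _ |- _ => destruct H as (? & ? & ?)
  | H : code_inA _ _ |- _ => unfold code_inA in H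
  | H : code_neg _ _ |- _ => unfold code_neg in H
  | H : code_conj _ _ |- _ => unfold code_conj in H
  | H : tagged _ ?c _, H' : tagged _ ?c _ |- _ =>
      destruct (tagged_inj _ _ _ _ _ H H') as [? ?]; clear H'; try discriminate; subst
  | H : is_opair ?p _ _, H' : is_opair ?p _ _ |- _ =>
      destruct (opair_inj _ _ _ _ _ H H') as [? ?]; clear H'; subst
  end.

Lemma form_step_subformula (Y : V -> Prop) (c d : V) :
  form_step Y c -> immediate_subformula d c -> Y d.
Proof.
  intros [(x & y & _ & _ & [H|H])|[(x & _ & H)|[(d' & hd & H)
    |[(f & _ & hf & H)|(W & d' & _ & hd & H)]]]]
    [H'|[(f' & i & H' & hi)|(W' & H')]]; code_inversion; eauto.
Qed.

Lemma formation_closed_iff (X : C) :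
  formation_closed X <-> forall c, form_step (fun d => d ∈c X) c -> c ∈c X.
Proof.
  split.
  - intros [h1 h2 h3 h4 h5 h6] c
      [(x & y & hx & hy & [H|H])|[(x & hx & H)|[(d & hd & H)
      |[(f & hf & hd & H)|(W & d & hW & hd & H)]]]];
      eauto.
  - intros h; split; intros; apply h; unfold form_step.
    + left; eauto 6.
    + left; eauto 6.
    + right; left; eauto.
    + right; right; left; eauto.
    + right; right; right; left; eauto.
    + right; right; right; right; eauto.
Qed.

(** [free_in] quantifies over classes and cannot occur in the recursion formula; here a relation
    given by a parameter takes its place. *)
Definition valuation_wrt (Fr : V -> V -> Prop) (c v : V) : Prop :=
  is_function v /\ forall x, in_dom x v <-> Fr x c.

(** The right-hand sides of the clauses for a truth predicate [Y]. *)
Definition truth_step (A : V -> Prop) (val Y : V -> V -> Prop) (c v : V) : Prop :=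
  (exists x y u w, code_eq c x y /\ app v x u /\ app v y w /\ u = w) \/
  (exists x y u w, code_in c x y /\ app v x u /\ app v y w /\ u ∈ w) \/
  (exists x u, code_inA c x /\ app v x u /\ A u) \/
  (exists f, code_conj c f /\
     forall i d v', app f i d -> val d v' -> subset v' v -> Y d v') \/
  (exists d, code_neg c d /\ ~ Y d v) \/
  (exists W d, code_all c W d /\
     forall b v', is_function b -> (forall x, in_dom x b <-> x ∈ W) ->
       val d v' -> (forall q, q ∈ v' -> q ∈ b \/ q ∈ v) -> Y d v').

(** [truth_step] consults [Y] only at immediate subformulas. Agreement there is two-sided because
    negation is not monotone in [Y]. *)
Lemma truth_step_mono (A A' : V -> Prop) (val val' Y Y' : V -> V -> Prop) (c v : V) :
  (forall x, A x <-> A' x) ->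
  (forall d v, val d v <-> val' d v) ->
  (forall d v, immediate_subformula d c -> (Y d v <-> Y' d v)) ->
  truth_step A val Y c v -> truth_step A' val' Y' c v.
Proof.
  intros hA hval hY [H|[H|[(x & u & H & hu & h)|[(f & H & h)|[(d & H & h)|(W & d & H & h)]]]]];
    unfold truth_step.
  - auto.
  - auto.
  - right; right; left; exists x, u; rewrite <- hA; auto.
  - right; right; right; left; exists f; split; [exact H|].
    intros i d v' hd hv'; rewrite <- hval in hv'; rewrite <- hY; [eauto|].
    right; left; exists f, i; auto.
  - right; right; right; right; left; exists d; split; [exact H|].
    rewrite <- hY; [exact h|left; exact H].
  - right; right; right; right; right; exists W, d; split; [exact H|].
    intros b v' hb hdom hv' hsub; rewrite <- hval in hv'; rewrite <- hY; [eauto|].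
    right; right; exists W; exact H.
Qed.

Lemma truth_step_ext (A A' : V -> Prop) (val val' Y Y' : V -> V -> Prop) (c v : V) :
  (forall x, A x <-> A' x) ->
  (forall d v, val d v <-> val' d v) ->
  (forall d v, immediate_subformula d c -> (Y d v <-> Y' d v)) ->
  (truth_step A val Y c v <-> truth_step A' val' Y' c v).
Proof.
  intros hA hval hY; split; apply truth_step_mono; auto; intros; symmetry; auto.
Qed.

(** One solution of ETR carries both recursions: tag 0 marks formulas, tag 1 marks pairs of a
    formula and a valuation. *)
Definition form_stage (S : C) (a c : V) : Prop := exists t, tagged 0 t c /\ pair_in S a t.

Definition truth_stage (S : C) (a c v : V) : Prop :=
  exists p t, is_opair p c v /\ tagged 1 t p /\ pair_in S a t.

(** The parameter of the recursion codes both [A] and the class of pairs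
    [<x, c>] with [x] free in [c]. *)
Lemma stages_exist (A : C) :
  exists S : C, forall a, ordinal a ->
    (forall c, form_stage S a c <->
       form_step (fun d => exists b, b ∈ a /\ form_stage S b d) c) /\
    (forall c v, truth_stage S a c v <->
       form_stage S a c /\ valuation c v /\
       truth_step (fun x => x ∈c A) valuation
         (fun d w => exists b, b ∈ a /\ truth_stage S b d w) c v).
Proof.
  destruct (free_in_class A) as [Fr hFr].
  destruct (comprehend (fun e P =>
      (exists x, tagged 0 (e None) x /\ P A x) \/ (exists p, tagged 1 (e None) p /\ P Fr p)))
    as [B hB]; [definability|]; simpl in hB.
  (* [F] and [G] read earlier formulas and earlier truth off the recursion; [val] and [A'] decode
     the parameter [B]. *)
  pose (F := fun (X : V -> Prop) d => exists t, tagged 0 t d /\ earlier X t).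
  pose (G := fun (X : V -> Prop) d w =>
    exists p t, is_opair p d w /\ tagged 1 t p /\ earlier X t).
  pose (val := fun B : V -> Prop =>
    valuation_wrt (fun x d => exists p t, is_opair p x d /\ tagged 1 t p /\ B t)).
  pose (A' := fun (B : V -> Prop) x => exists t, tagged 0 t x /\ B t).
  (* The truth disjunct repeats [form_step], so truth at a stage speaks only of formulas of that
     stage. *)
  destruct (etr_recursion (fun e P =>
      (exists c, tagged 0 (e tt) c /\ form_step (F (P varX)) c) \/
      (exists c v p, is_opair p c v /\ tagged 1 (e tt) p /\ form_step (F (P varX)) c /\
         val (P varA) c v /\
         truth_step (A' (P varA)) (val (P varA)) (G (P varX)) c v)) B) as [S hS].
  { unfold F, G, val, A', form_step, truth_step, valuation_wrt, is_function, earlier.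
    definability. }
  assert (hF : forall a c, F (restriction S a) c <-> exists b, b ∈ a /\ form_stage S b c).
  { intros a c; unfold F, form_stage; split.
    - intros (t & ht & h); apply earlier_restriction in h as (b & hb & h); eauto.
    - intros (b & hb & t & ht & h); exists t; split; [|apply earlier_restriction]; eauto. }
  assert (hG : forall a c v,
    G (restriction S a) c v <-> exists b, b ∈ a /\ truth_stage S b c v).
  { intros a c v; unfold G, truth_stage; split.
    - intros (p & t & hp & ht & h); apply earlier_restriction in h as (b & hb & h); eauto 7.
    - intros (b & hb & p & t & hp & ht & h); exists p, t.
      split; [|split]; auto; apply earlier_restriction; eauto. }
  assert (hA' : forall x, A' (fun z => z ∈c B) x <-> x ∈c A).
  { intros x; unfold A'; split.
    - intros (t & ht & h); apply hB in h as [(y & hy & h)|(y & hy & h)]; code_inversion; auto.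
    - intros h; destruct (tagged_exists 0 x) as [t ht].
      exists t; split; [exact ht|]; apply hB; left; exists x; auto. }
  assert (hval : forall c v, val (fun z => z ∈c B) c v <-> valuation c v).
  { intros c v.
    enough (h : forall x,
      (exists p t, is_opair p x c /\ tagged 1 t p /\ t ∈c B) <-> free_in x c).
    { unfold val, valuation_wrt, valuation.
      split; intros [hv hd]; (split; [exact hv|]); intros x; rewrite (hd x), (h x); tauto. }
    intros x; rewrite <- hFr; split.
    - intros (p & t & hp & ht & h); exists p; split; [exact hp|].
      apply hB in h as [(y & hy & h)|(y & hy & h)]; code_inversion; auto.
    - intros (p & hp & h); destruct (tagged_exists 1 p) as [t ht].
      exists p, t; split; [|split]; auto; apply hB; right; exists p; auto. }
  exists S; intros a ha; specialize (hS a ha).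
  assert (hform : forall c, form_stage S a c <->
      form_step (fun d => exists b, b ∈ a /\ form_stage S b d) c).
  { intros c; split.
    - intros (t & ht & h); apply hS in h as [(d & hd & h)|(d & v & p & hp & hd & h)];
        code_inversion.
      revert h; apply form_step_mono; intros d'; apply hF.
    - intros h; destruct (tagged_exists 0 c) as [t ht]; exists t; split; [exact ht|].
      apply hS; left; exists c; split; [exact ht|].
      revert h; apply form_step_mono; intros d; apply hF. }
  split; [exact hform|]; intros c v.
  rewrite hform, <- (hval c v).
  rewrite <- (truth_step_ext _ _ _ _ _ _ c v hA' hval (fun d w _ => hG a d w)).
  split.
  - intros (p & t & hp & ht & h); apply hS in h
      as [(d & hd & h)|(d & w & p' & hp' & hd & h1 & h2 & h3)]; code_inversion.
    split; [|split]; [|exact h2|exact h3].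
    revert h1; apply form_step_mono; intros d'; apply hF.
  - intros (h1 & h2 & h3).
    destruct (opair_exists c v) as [p hp], (tagged_exists 1 p) as [t ht].
    exists p, t; split; [|split]; auto; apply hS; right; exists c, v, p.
    split; [|split; [|split; [|split]]]; [exact hp|exact ht| |exact h2|exact h3].
    revert h1; apply form_step_mono; intros d; apply hF.
Qed.

(** * Coherence of the stages and the clauses for truth *)

Section Stages.

Context (A S : C).

Local Notation F := (form_stage S).
Local Notation G := (truth_stage S).

Context (form_stage_iff : forall a, ordinal a -> forall c,
  F a c <-> form_step (fun d => exists b, b ∈ a /\ F b d) c).
Context (truth_stage_iff : forall a, ordinal a -> forall c v,
  G a c v <-> F a c /\ valuation c v /\
    truth_step (fun x => x ∈c A) valuation (fun d w => exists b, b ∈ a /\ G b d w) c v).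

(** Least stages and replacement bound the stages of all conjuncts at once. *)
Lemma form_stage_bound (f : V) :
  (forall i d, app f i d -> exists a, ordinal a /\ F a d) ->
  exists a, ordinal a /\ forall i d, app f i d -> exists b, b ∈ a /\ F b d.
Proof.
  intros hf.
  destruct (comprehend (fun e P => exists p m, is_opair (e None) p m /\
      exists i d, is_opair p i d /\
        least_ordinal (fun b => exists t, tagged 0 t d /\ exists q, is_opair q b t /\ P S q) m))
    as [H hH]; [unfold least_ordinal; definability|]; cbv beta in hH; simpl in hH.
  assert (hH' : forall p m, pair_in H p m <->
    exists i d, is_opair p i d /\ least_ordinal (fun b => F b d) m).
  { intros p m; destruct (opair_exists p m) as [r hr].
    rewrite (pair_in_iff _ _ _ _ hr), hH; split.
    - intros (p' & m' & hr' & h); destruct (opair_inj _ _ _ _ _ hr hr') as [<- <-]; exact h.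
    - intros h; exists p, m; auto. }
  (* [H] sends a pair [<i, d>] in [f] to the least stage of [d], so its image is a set of ordinals.
     The bound taken on it is strict, as [form_stage_iff] looks only below [a]. *)
  destruct (replacement hGBC H) with (a := f) as [b hb].
  { intros p m m' h h'; apply hH' in h as (i & d & hp & h), h' as (i' & d' & hp' & h').
    destruct (opair_inj _ _ _ _ _ hp hp') as [<- <-]; exact (least_ordinal_unique _ _ _ h h'). }
  destruct (ordinal_bound b) as (a & ha & hba).
  { intros m hm; apply hb in hm as (p & _ & h); apply hH' in h as (i & d & _ & h & _).
    exact h. }
  exists a; split; [exact ha|]; intros i d hd.
  destruct (hf i d hd) as (a' & ha' & h).
  destruct (least_ordinal_exists (fun b => F b d) a') as [m hm]; auto.
  { refine (comprehend (fun e P => exists t, tagged 0 t (e (Some d)) /\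
      exists q, is_opair q (e None) t /\ P S q) _); definability. }
  exists m; split; [|apply hm].
  apply hba, hb; destruct hd as (p & hp & hpf); exists p; split; [exact hpf|].
  apply hH'; exists i, d; auto.
Qed.

(** The union of the stages is formation-closed, and each stage lies in every formation-closed
    class. *)
Lemma formula_iff (c : V) : formula c <-> exists a, ordinal a /\ F a c.
Proof.
  split.
  - intros h.
    destruct (comprehend (fun e P => exists a, ordinal a /\
        exists t, tagged 0 t (e None) /\ exists q, is_opair q a t /\ P S q))
      as [X hX]; [definability|].
    apply hX, h, formation_closed_iff; clear c h; intros c h; apply hX.
    assert (h' : form_step (fun d => exists a, ordinal a /\ F a d) c).
    { revert h; apply form_step_mono; intros d; apply hX. }
    clear h.
    (* All premises must lie below one ordinal: any ordinal for atoms, a successor for a single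
       premise, [form_stage_bound] for a conjunction. *)
    enough (exists a, ordinal a /\ form_step (fun d => exists b, b ∈ a /\ F b d) c)
      as (a & ha & h) by (exists a; split; [|apply form_stage_iff]; auto).
    unfold form_step.
    destruct h' as [H|[H|[(d & (a & ha & hd) & H)
      |[(f & hf & hd & H)|(W & d & hW & (a & ha & hd) & H)]]]].
    + destruct ordinal_exists as [a ha]; eauto.
    + destruct ordinal_exists as [a ha]; eauto.
    + destruct (ordinal_above a ha) as (b & hb & hab); exists b; split; [exact hb|].
      right; right; left; eauto 6.
    + destruct (form_stage_bound f hd) as (a & ha & h); exists a; split; [exact ha|].
      right; right; right; left; eauto.
    + destruct (ordinal_above a ha) as (b & hb & hab); exists b; split; [exact hb|].
      right; right; right; right; eauto 8.
  - intros (a & ha & h) X hX; revert c h.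
    pattern a; revert a ha; apply ordinal_induction.
    + refine (comprehend (fun e P => forall c, (exists t, tagged 0 t c /\
        exists q, is_opair q (e None) t /\ P S q) -> P X c) _); definability.
    + intros a ha IH c h; apply (proj1 (formation_closed_iff X) hX).
      apply form_stage_iff in h; [|exact ha].
      revert h; apply form_step_mono; intros d (b & hb & h); eauto.
Qed.

Lemma subformula_stage (a c d : V) :
  ordinal a -> F a c -> immediate_subformula d c -> exists b, ordinal b /\ b ∈ a /\ F b d.
Proof.
  intros ha h hd; apply (form_stage_iff a ha) in h.
  destruct (form_step_subformula _ _ _ h hd) as (b & hb & hb').
  exists b; split; [exact (ordinal_elem a b ha hb)|auto].
Qed.

Lemma truth_stage_form (a c v : V) : ordinal a -> G a c v -> F a c.
Proof. intros ha h; apply (truth_stage_iff a ha) in h; apply h. Qed.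

(** A formula occurs at many stages, but only its immediate subformulas matter
    at each of them, and these occur earlier. *)
Lemma truth_stage_coherent (a : V) : ordinal a ->
  forall b c v, ordinal b -> F a c -> F b c -> (G a c v <-> G b c v).
Proof.
  revert a; apply (ordinal_induction (fun a => forall b c v,
    ordinal b -> F a c -> F b c -> (G a c v <-> G b c v))).
  (* [F'] and [G'] are the stages unfolded down to membership in [S], which exhibits the induction
     predicate as definable. *)
  - pose (F' := fun (P : V -> Prop) a c =>
      exists t, tagged 0 t c /\ exists q, is_opair q a t /\ P q).
    pose (G' := fun (P : V -> Prop) a c v => exists p t,
      is_opair p c v /\ tagged 1 t p /\ exists q, is_opair q a t /\ P q).
    refine (comprehend (fun e P => forall b c v, ordinal b ->
      F' (P S) (e None) c -> F' (P S) b c ->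
      (G' (P S) (e None) c v <-> G' (P S) b c v)) _).
    unfold F', G'; definability.
  - intros a ha IH b c v hb hac hbc.
    rewrite (truth_stage_iff a ha), (truth_stage_iff b hb).
    enough (h : forall d w, immediate_subformula d c ->
      ((exists a', a' ∈ a /\ G a' d w) <-> (exists b', b' ∈ b /\ G b' d w))).
    { rewrite (truth_step_ext _ (fun x => x ∈c A) _ valuation _ _ c v
        (fun x => iff_refl _) (fun d w => iff_refl _) h); tauto. }
    intros d w hd.
    destruct (subformula_stage a c d ha hac hd) as (a0 & ha0 & ha0a & hF0).
    destruct (subformula_stage b c d hb hbc hd) as (b0 & hb0 & hb0b & hF0').
    split.
    + intros (a' & ha' & h); exists b0; split; [exact hb0b|].
      assert (hoa' := ordinal_elem a a' ha ha').
      apply (IH a' ha' b0 d w); eauto using truth_stage_form.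
    (* The induction hypothesis covers only ordinals below [a], so it is used at [a0], with [b'] as
       the arbitrary second stage. *)
    + intros (b' & hb' & h); exists a0; split; [exact ha0a|].
      assert (hob' := ordinal_elem b b' hb hb').
      apply (IH a0 ha0a b' d w); eauto using truth_stage_form.
Qed.

Context (T : C).
Context (hT : forall q, q ∈c T <->
  exists c v, is_opair q c v /\ exists a, ordinal a /\ G a c v).

Lemma pair_in_truth (c v : V) : pair_in T c v <-> exists a, ordinal a /\ G a c v.
Proof.
  destruct (opair_exists c v) as [q hq]; rewrite (pair_in_iff _ _ _ _ hq), hT; split.
  - intros (c' & v' & hq' & h); destruct (opair_inj _ _ _ _ _ hq hq') as [<- <-]; exact h.
  - intros h; exists c, v; auto.
Qed.

(** By coherence [T] agrees with every stage at which a formula occurs, so the recursion clause at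
    one stage of [c] transfers to [T] through the immediate subformulas. *)
Lemma truth_iff (c v : V) : formula c -> valuation c v ->
  (pair_in T c v <-> truth_step (fun x => x ∈c A) valuation (pair_in T) c v).
Proof.
  intros hc hv; apply formula_iff in hc as (a & ha & hac).
  assert (hstage : forall b d w, ordinal b -> F b d -> (pair_in T d w <-> G b d w)).
  { intros b d w hb hd; rewrite pair_in_truth; split; [|eauto].
    intros (b' & hb' & h); apply (truth_stage_coherent b' hb' b d w); eauto using truth_stage_form. }
  rewrite (hstage a c v ha hac), (truth_stage_iff a ha).
  rewrite (truth_step_ext _ (fun x => x ∈c A) _ valuation _ (pair_in T) c v
    (fun x => iff_refl _) (fun d w => iff_refl _)); [tauto|].
  intros d w hd; destruct (subformula_stage a c d ha hac hd) as (b & hb & hba & hbd).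
  rewrite (hstage b d w hb hbd); split; [|eauto].
  intros (b' & hb' & h).
  assert (hob' := ordinal_elem a b' ha hb').
  apply (truth_stage_coherent b' hob' b d w); eauto using truth_stage_form.
Qed.

Ltac truth_step_inversion :=
  intros [(x' & y' & u' & w' & H & hu' & hw' & h)
    |[(x' & y' & u' & w' & H & hu' & hw' & h)
    |[(x' & u' & H & hu' & h)|[(f' & H & h)|[(d' & H & h)|(W' & d' & H & h)]]]]];
  code_inversion.

(** Each clause is [truth_iff] for one shape of code: unique readability discards the other shapes,
    and in the atomic clauses functionality of the valuation identifies the values. *)
Lemma truth_predicate_of_stages : truth_predicate A T.
Proof.
  split.
  - intros q hq; apply hT in hq as (c & v & hq & a & ha & h); exists c, v.
    split; [exact hq|]; split.
    + apply formula_iff; exists a; split; [|apply truth_stage_form in h]; auto.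
    + apply truth_stage_iff in h; tauto.
  - intros c x y v u w hx hy hc hv hu hw.
    assert (hf : formula c) by (intros X hX; exact (form_eq _ hX _ _ _ hx hy hc)).
    rewrite (truth_iff c v hf hv); split.
    + truth_step_inversion.
      destruct hv as [[_ hv] _]; rewrite (hv _ _ _ hu hu'), (hv _ _ _ hw hw'); reflexivity.
    + intros h; left; exists x, y, u, w; auto.
  - intros c x y v u w hx hy hc hv hu hw.
    assert (hf : formula c) by (intros X hX; exact (form_in _ hX _ _ _ hx hy hc)).
    rewrite (truth_iff c v hf hv); split.
    + truth_step_inversion.
      destruct hv as [[_ hv] _]; rewrite (hv _ _ _ hu hu'), (hv _ _ _ hw hw'); exact h.
    + intros h; right; left; exists x, y, u, w; auto.
  - intros c x v u hx hc hv hu.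
    assert (hf : formula c) by (intros X hX; exact (form_inA _ hX _ _ hx hc)).
    rewrite (truth_iff c v hf hv); split.
    + truth_step_inversion.
      destruct hv as [[_ hv] _]; rewrite (hv _ _ _ hu hu'); exact h.
    + intros h; right; right; left; exists x, u; auto.
  - intros c f v hf hc hv.
    rewrite (truth_iff c v hf hv); split.
    + truth_step_inversion; exact h.
    + intros h; right; right; right; left; exists f; auto.
  - intros c d v hf hc hv.
    rewrite (truth_iff c v hf hv); split.
    + truth_step_inversion; exact h.
    + intros h; right; right; right; right; left; exists d; auto.
  - intros c W d v hf hc hv.
    rewrite (truth_iff c v hf hv); split.
    + truth_step_inversion; exact h.
    + intros h; right; right; right; right; right; exists W, d; auto.
Qed.

End Stages.

End Proof.

Theorem theorem16 (M : class_structure) (hGBC : GBC M) (hETR : ETR_Ord M)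
    (A : vclass M) :
  exists T : vclass M, truth_predicate A T.
Proof.
  destruct (stages_exist hGBC hETR A) as [S hS].
  (* [T] is the union of the truth stages, with [truth_stage] spelled out so that the only class
     parameter is [S]. *)
  destruct (comprehend hGBC (fun e P => exists c v, is_opair (e None) c v /\
      exists a, ordinal a /\ exists p t, is_opair p c v /\ tagged 1 t p /\
        exists q, is_opair q a t /\ P S q)) as [T hT]; [definability|].
  exists T; apply (truth_predicate_of_stages hGBC A S).
  - intros a ha; apply (hS a ha).
  - intros a ha; apply (hS a ha).
  - exact hT.
Qed.
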